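(* Let $X$ be a spectral space and let $\mathcal O(X)$ be the lattice of open subsets of $X$, with compact elements $\mathcal O(X)^c$. (1) $\mathcal O(X)^c$ is a radical idealic semiring. (2) There are homeomorphisms $X\cong \mathrm{Zar}(\mathcal O(X))\cong \mathrm{Spec}_k(\mathcal O(X)^c)$.
   Context: A spectral space is a quasi-compact $T_0$ topological space in which finite intersections of quasi-compact open subsets are quasi-compact open, the quasi-compact open subsets form a basis, and every nonempty irreducible closed subset has a unique generic point. A semiring is a nonempty set $A$ with operations $+,\cdot$ such that $(A,+)$ and $(A,\cdot)$ are commutative monoids (identities $0$ and $1$), $(a+b)c=ac+bc$ and $0\cdot a=0$. It is idempotent if $a+a=a$ for all $a$, with canonical order $x\le y\iff x+y=y$; an idempotent semiring is idealic if $x\le1$ for all $x$, an idealic semiring is radical if $x^2=x$ for all $x$, and an idempotent semiring is complete if every subset has a least upper bound in the canonical order. $\mathcal O(X)$ is the complete lattice of open subsets of $X$ ordered by inclusion; it is regarded as a complete idealic semiring with addition given by union and multiplication given by intersection. An element $x$ of a complete lattice is compact if whenever $x\le\bigvee_{i\in\Gamma}y_i$ there is a finite $I\subseteq\Gamma$ with $x\le\bigvee_{i\in I}y_i$. $\mathcal O(X)^c$ is the set of compact elements of $\mathcal O(X)$ (the quasi-compact open subsets), with the operations union and intersection. For a complete idealic semiring $B$, an element $\mathfrak p\in B$, $\mathfrak p\neq 1$, is prime if $xy\le\mathfrak p$ implies $x\le\mathfrak p$ or $y\le\mathfrak p$; the Zariski space $\mathrm{Zar}(B)$ is the set of prime elements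 of $B$ with closed sets $V(x)=\{\mathfrak p\text{ prime}\mid x\le\mathfrak p\}$, $x\in B$. An ideal of a semiring $A$ is an additive submonoid $I$ with $AI\subseteq I$; it is a $k$-ideal if $x\in I$ and $x+y\in I$ imply $y\in I$. For $k$-ideals $I,J$, $IJ$ is the smallest $k$-ideal containing all products $xy$, $x\in I,y\in J$. A prime $k$-ideal is a proper $k$-ideal $\mathfrak p$ such that for $k$-ideals $I,J$, $IJ\subseteq\mathfrak p$ implies $I\subseteq\mathfrak p$ or $J\subseteq\mathfrak p$. $\mathrm{Spec}_kA$ is the set of prime $k$-ideals with the hull-kernel topology, i.e. the topology with open sub-basis $\{\mathfrak p\mid F\not\subseteq\mathfrak p\}$, $F\subseteq A$ finite. *)

(* Defs.v *)
From HB Require Import structures.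
From mathcomp Require Import all_boot all_order all_algebra.
From mathcomp Require Import all_classical topology.

Set Implicit Arguments.
Unset Strict Implicit.
Unset Printing Implicit Defensive.

Import GRing.Theory.
Local Open Scope classical_set_scope.
Local Open Scope ring_scope.

Definition homeomorphic (X Y : topologicalType) : Prop :=
  exists (f : X -> Y) (g : Y -> X),
    [/\ continuous f, continuous g, cancel f g & cancel g f].

Section Spectral.
Variable X : topologicalType.

(* [compact] does not include the Hausdorff property. *)
Definition qc_open : set (set X) := [set U | open U /\ compact U].

Definition irreducible (C : set X) : Prop :=
  C !=set0 /\ forall F G : set X, closed F -> closed G ->
    C `<=` F `|` G -> C `<=` F \/ C `<=` G.

Definition generic_point (C : set X) (x : X) : Prop := closure [set x] = C.

(* The empty family, with intersection X, is allowed in [spectral_capQ]. *)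
Record spectral_space : Prop := SpectralSpace {
  spectral_compact : compact [set: X] ;
  spectral_T0 : kolmogorov_space X ;
  spectral_capQ : forall D : set (set X), finite_set D -> D `<=` qc_open ->
    qc_open (\bigcap_(U in D) U) ;
  spectral_basis : basis qc_open ;
  spectral_sober : forall C : set X, closed C -> irreducible C ->
    exists! x, generic_point C x }.

End Spectral.

(* Semirings are [comPzSemiRingType]s: commutative, and 0 = 1 is allowed. *)
Section IdempotentSemirings.
Variable A : comPzSemiRingType.

Definition idempotent_semiring : Prop := forall a : A, a + a = a.

(* On open sets this order is inclusion: see [opens_cleE]. *)
Definition cle (x y : A) : Prop := x + y = y.

Definition idealic_semiring : Prop :=
  idempotent_semiring /\ forall x : A, cle x 1.

Definition radical_idealic_semiring : Prop :=
  idealic_semiring /\ forall x : A, x ^+ 2 = x.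

Definition is_csup (S : set A) (s : A) : Prop :=
  (forall x, S x -> cle x s) /\
  (forall u, (forall x, S x -> cle x u) -> cle s u).

Definition complete_semiring : Prop :=
  idempotent_semiring /\ forall S : set A, exists s, is_csup S s.

End IdempotentSemirings.

HB.mixin Record isCompleteIdealic A of GRing.ComPzSemiRing A := {
  idealicP : idealic_semiring A ;
  completeP : complete_semiring A }.

#[short(type="completeIdealicType")]
HB.structure Definition CompleteIdealic :=
  { A of GRing.ComPzSemiRing A & isCompleteIdealic A }.

Section CompactElements.
Variable B : completeIdealicType.

(* The default 0 of [xget] is never used, by [csupP]. *)
Definition csup (S : set B) : B := xget 0 (is_csup S).

Lemma csupP (S : set B) : is_csup S (csup S).
Proof. by have [_ /(_ S)[s Ss]] := @completeP B; exact: (xgetI 0 Ss). Qed.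

Definition compact_elt (x : B) : Prop :=
  forall (I : Type) (y : I -> B), cle x (csup (range y)) ->
  exists J : set I, finite_set J /\ cle x (csup (y @` J)).

Definition compact_elts : {pred B} := fun x => `[< compact_elt x >].

End CompactElements.
Arguments compact_elts B : clear implicits.

Section SubSemiring.
Variables (A : comPzSemiRingType) (S : {pred A}).

(* clS occurs only as a parameter of the type, so that the semiring instance
   below, whose operations are induced by those of A, can depend on it. *)
Record subsemiring (clS : semiring_closed S) := SubSemiring {
  subsemiring_val :> A ; _ : subsemiring_val \in S }.

Variable clS : semiring_closed S.
HB.instance Definition _ := [isSub for @subsemiring_val clS].
HB.instance Definition _ := [Choice of subsemiring clS by <:].
HB.instance Definition _ :=
  GRing.SubChoice_isSubComPzSemiRing.Build A S (subsemiring clS) clS.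

End SubSemiring.

Section Zariski.
Variable B : completeIdealicType.

Definition prime_elt (p : B) : Prop :=
  p <> 1 /\ forall x y : B, cle (x * y) p -> cle x p \/ cle y p.

Record zar := Zar { zar_val : B ; zarP : prime_elt zar_val }.

Definition zar_V (x : B) : set zar := [set p : zar | cle x (zar_val p)].

HB.instance Definition _ := gen_eqMixin zar.
HB.instance Definition _ := gen_choiceMixin zar.

Definition zar_open : set (set zar) := [set U | exists x : B, ~` U = zar_V x].

Lemma cle_trans (y x z : B) : cle x y -> cle y z -> cle x z.
Proof. by rewrite /cle => xy yz; rewrite -yz addrA xy. Qed.

Lemma cle_mulr (x y : B) : cle (x * y) x.
Proof.
have [_ /(_ y)] := @idealicP B; rewrite /cle => y1.
by rewrite -[X in _ + X]mulr1 -mulrDr y1 mulr1.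
Qed.

Lemma cle_mull (x y : B) : cle (x * y) y.
Proof. by rewrite mulrC; exact: cle_mulr. Qed.

Lemma zar_openT : zar_open setT.
Proof.
exists 1; rewrite setCT predeqE => p; split=> // p1.
have [p_neq1 _] := zarP p; apply: p_neq1.
have [_ /(_ (zar_val p))] := @idealicP B; rewrite /cle => <-.
by rewrite addrC p1.
Qed.

Lemma zar_openI : setI_closed zar_open.
Proof.
move=> U V [x Ux] [y Vy]; exists (x * y).
rewrite setCI Ux Vy predeqE => p; split=> [[xp|yp]|].
- exact: cle_trans (cle_mulr x y) xp.
- exact: cle_trans (cle_mull x y) yp.
- by case: (zarP p) => _; apply.
Qed.

Lemma zar_open_bigU (I : Type) (f : I -> set zar) :
  (forall i, zar_open (f i)) -> zar_open (\bigcup_i f i).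
Proof.
move=> /choice[x fx]; exists (csup (range x)).
have [xub xlub] := csupP (range x).
rewrite setC_bigcup predeqE => p; split=> [fp|xp i _].
- by apply: xlub => _ [i _ <-]; have := fp i Logic.I; rewrite fx.
- by rewrite fx; apply: cle_trans xp; apply: xub; exists i.
Qed.

HB.instance Definition _ :=
  isOpenTopological.Build zar zar_openT zar_openI zar_open_bigU.

End Zariski.

Section SpecK.
Variable A : comPzSemiRingType.

Definition is_ideal (I : set A) : Prop :=
  [/\ I 0, (forall x y, I x -> I y -> I (x + y))
    & (forall a x, I x -> I (a * x))].

Definition is_kideal (I : set A) : Prop :=
  is_ideal I /\ forall x y, I x -> I (x + y) -> I y.

Definition kideal_mul (I J : set A) : set A :=
  smallest is_kideal [set z | exists x y, [/\ I x, J y & z = x * y]].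

Definition prime_kideal (p : set A) : Prop :=
  [/\ is_kideal p, p <> setT
    & forall I J : set A, is_kideal I -> is_kideal J ->
        kideal_mul I J `<=` p -> I `<=` p \/ J `<=` p].

Record spec_k := SpecK {
  spec_k_val :> set A ; spec_kP : prime_kideal spec_k_val }.

HB.instance Definition _ := gen_eqMixin spec_k.
HB.instance Definition _ := gen_choiceMixin spec_k.

Definition spec_k_D (F : set A) : set spec_k := [set p : spec_k | ~ F `<=` p].

HB.instance Definition _ :=
  isSubBaseTopological.Build spec_k [set F : set A | finite_set F] spec_k_D.

End SpecK.

Section Opens.
Variable X : topologicalType.

Record opens := Opens { opens_val :> set X ; opensP : open opens_val }.

HB.instance Definition _ := gen_eqMixin opens.
HB.instance Definition _ := gen_choiceMixin opens.

Lemma opens_inj (U V : opens) : U = V :> set X -> U = V.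
Proof.
by case: U V => [U oU] [V oV] /= UV; subst V; congr Opens; exact: Prop_irrelevance.
Qed.

Definition opens0 : opens := Opens open0.
Definition opens1 : opens := Opens openT.
Definition opensU (U V : opens) : opens := Opens (openU (opensP U) (opensP V)).
Definition opensI (U V : opens) : opens := Opens (openI (opensP U) (opensP V)).

Lemma opensUA : associative opensU.
Proof. by move=> U V W; apply: opens_inj; exact: setUA. Qed.
Lemma opensUC : commutative opensU.
Proof. by move=> U V; apply: opens_inj; exact: setUC. Qed.
Lemma opens0U : left_id opens0 opensU.
Proof. by move=> U; apply: opens_inj; exact: set0U. Qed.
Lemma opensIA : associative opensI.
Proof. by move=> U V W; apply: opens_inj; exact: setIA. Qed.
Lemma opensIC : commutative opensI.
Proof. by move=> U V; apply: opens_inj; exact: setIC. Qed.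
Lemma opens1I : left_id opens1 opensI.
Proof. by move=> U; apply: opens_inj; exact: setTI. Qed.
Lemma opensIUl : left_distributive opensI opensU.
Proof. by move=> U V W; apply: opens_inj; exact: setIUl. Qed.
Lemma opens0I : left_zero opens0 opensI.
Proof. by move=> U; apply: opens_inj; exact: set0I. Qed.

HB.instance Definition _ :=
  GRing.isNmodule.Build opens opensUA opensUC opens0U.
HB.instance Definition _ := GRing.Nmodule_isComPzSemiRing.Build opens
  opensIA opensIC opens1I opensIUl opens0I.

Lemma opens_cleE (U V : opens) : cle U V <-> (U : set X) `<=` V.
Proof.
split=> [UV|/setUidPr UV]; last exact: opens_inj.
by apply/setUidPr; exact: (congr1 opens_val UV).
Qed.

Lemma opens_idealic : idealic_semiring opens.
Proof.
split=> U; first by apply: opens_inj; exact: setUid.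
by apply/opens_cleE.
Qed.

Lemma opens_complete : complete_semiring opens.
Proof.
split=> [|S]; first exact: opens_idealic.1.
have oS : open (\bigcup_(U in S) (U : set X)).
  by apply: bigcup_open => U _; exact: opensP.
exists (Opens oS); split=> [U SU|V SV]; apply/opens_cleE => /=.
- by move=> x Ux; exists U.
- by move=> x [U /SV /opens_cleE]; apply.
Qed.

HB.instance Definition _ :=
  isCompleteIdealic.Build opens opens_idealic opens_complete.

End Opens.

(* Main.v *)
(* A prime element of O(X) is an open set with irreducible complement, so by
   sobriety it is the complement of the closure of a unique point; U lies below
   the prime attached to x exactly when x is not in U. Since quasi-compact opens
   form a basis, an open set is determined by the quasi-compact opens below it,
   and compactness makes an ideal of O(X)^c recoverable from its union: this
   gives mutually inverse maps between open sets and k-ideals, which match prime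
   elements with prime k-ideals. *)
Require Import Defs.
From HB Require Import structures.
From mathcomp Require Import all_boot all_order all_algebra.
From mathcomp Require Import finmap.
From mathcomp Require Import all_classical topology.

Set Implicit Arguments.
Unset Strict Implicit.
Unset Printing Implicit Defensive.

Import GRing.Theory.
Local Open Scope classical_set_scope.
Local Open Scope ring_scope.

(** * Open sets of [zar] and [spec_k]; ideals of idempotent semirings *)

Lemma zar_inj (B : completeIdealicType) : injective (@zar_val B).
Proof.
by case=> [p hp] [q hq] /= pq; subst q; congr Zar; exact: Prop_irrelevance.
Qed.

Lemma spec_k_inj (A : comPzSemiRingType) : injective (@spec_k_val A).
Proof.
by case=> [p hp] [q hq] /= pq; subst q; congr SpecK; exact: Prop_irrelevance.
Qed.

Lemma zar_openE (B : completeIdealicType) (U : set (zar B)) :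
  open U <-> exists x, U = ~` zar_V x.
Proof.
split=> -[x Ux]; exists x; first by rewrite -Ux setCK.
by rewrite Ux setCK.
Qed.

Lemma spec_k_open_D (A : comPzSemiRingType) (F : set A) :
  finite_set F -> open (spec_k_D F).
Proof.
move=> finF; exists [set spec_k_D F]; last exact: bigcup_set1.
by move=> _ ->; exact: finI_from1.
Qed.

(** Preimages commute with the unions and finite intersections that build every open set from the
    sub-basis. *)
Lemma continuous_spec_k (T : topologicalType) (A : comPzSemiRingType)
    (f : T -> spec_k A) :
  (forall F, finite_set F -> open (f @^-1` spec_k_D F)) -> continuous f.
Proof.
move=> fD; apply/continuousP => _ [E sE <-]; rewrite preimage_bigcup.
apply: bigcup_open => _ /sE[J sJ <-]; rewrite preimage_bigcap.
rewrite openE => t ft; apply: filter_bigI => F FJ.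
apply: open_nbhs_nbhs; split; last exact: ft.
by apply: fD; have := sJ _ FJ; rewrite inE.
Qed.

(** These principal k-ideals let primeness, which is stated for k-ideals, be tested on elements.
    Absorption holds because [a * x + x = (a + 1) * x = x]. *)
Lemma kideal_cle (A : comPzSemiRingType) (c : A) :
  idealic_semiring A -> is_kideal [set a | cle a c].
Proof.
move=> [idem le1]; split; first split; rewrite /cle /=.
- exact: add0r.
- by move=> x y xc yc; rewrite -addrA yc.
- move=> a x xc; have ax : a * x + x = x.
    by rewrite -[X in _ + X]mul1r -mulrDl le1 mul1r.
  by rewrite -xc addrA ax.
- move=> x y xc; rewrite -addrA => xyc.
  by rewrite -{1}xyc [LHS]addrCA (addrA y y) idem.
Qed.

(** The bound is the sum of [J], which by idempotence absorbs each of its terms. *)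
Lemma finite_ideal_ub (A : comPzSemiRingType) (I J : set A) :
  idempotent_semiring A -> is_ideal I -> finite_set J -> J `<=` I ->
  exists2 s, I s & forall a, J a -> cle a s.
Proof.
move=> idem [I0 ID _] /finite_fsetP[K ->] KI; exists (\sum_(a <- K) a).
  by rewrite big_seq; apply: big_ind.
by move=> a /= aK; rewrite /cle (big_rem a) //= addrA idem.
Qed.

(** * Compact elements of the lattice of open sets *)

Section OpenSets.
Variable X : topologicalType.
Implicit Types (U V : opens X) (S : set (opens X)).

Lemma opens_csupE S : (csup S : set X) = \bigcup_(U in S) (U : set X).
Proof.
have [ub lub] := csupP S; apply/seteqP; split; last first.
  by move=> x [U /ub/opens_cleE US Ux]; exact: US.
have oS : open (\bigcup_(U in S) (U : set X)).
  by apply: bigcup_open => U _; exact: opensP.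
suff /opens_cleE : cle (csup S) (Opens oS) by [].
by apply: lub => U SU; apply/opens_cleE => x Ux; exists U.
Qed.

(* The library characterizes compactness by covers only in pointed spaces,
   which excludes the empty one. *)
Lemma compact_opensE U : compact_elt U <-> compact U.
Proof.
split=> [cU F PF FU|cU I y /opens_cleE].
  apply: contrapT => noclu.
  (* The default [0], the empty set, keeps the complement of every member of the family in [F]. *)
  pose y V := if `[< F (~` (V : set X)) >] then V else 0.
  have yF V : F (~` (y V : set X)).
    rewrite /y; case: asboolP => // _.
    by rewrite setC0; exact: filterT.
  have [|J [finJ]] := cU _ y.
    apply/opens_cleE => x Ux.
    (* A non-cluster point has a neighbourhood [B] missing some [W] in [F], so the complement of the
       interior of [B] is in [F]. *)
    have /existsNP[W /existsNP[B /not_implyP[FW /not_implyP[xB WB]]]] :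
        ~ cluster F x by move=> Fx; apply: noclu; exists x.
    rewrite opens_csupE bigcup_image; exists (Opens (open_interior B)) => //.
    rewrite /y; case: asboolP => //=; case; apply: filterS FW => w Ww /= Bw.
    by apply: WB; exists w; split=> //; exact: interior_subset.
  move=> /opens_cleE; rewrite opens_csupE bigcup_image => UJ.
  have /finite_fsetP[K JK] := finJ.
  have FK : F (\bigcap_(V in [set` K]) ~` (y V : set X)).
    by apply: filter_bigI.
  have [x [Ux nx]] := filter_ex (filterI FU FK).
  by have [V JV yVx] := UJ x Ux; apply: (nx V) yVx; rewrite -JK.
rewrite opens_csupE bigcup_image => Uy; apply: contrapT => noJ.
(* Without a finite subcover the remainders [G J] form a base of a proper filter containing [U]. Its
   cluster point in [U] lies in some [y i], yet [y i] misses [G [set i]]. *)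
pose G J := (U : set X) `\` \bigcup_(i in J) (y i : set X).
have PG : ProperFilter (filter_from (@finite_set I) G).
  apply: filter_from_proper; last first.
    move=> J finJ; apply: contrapT => GJ0; apply: noJ; exists J; split=> //.
    apply/opens_cleE; rewrite opens_csupE bigcup_image => x Ux.
    by apply: contrapT => nx; apply: GJ0; exists x.
  apply: filter_from_filter; first by exists set0; exact: finite_set0.
  move=> J K finJ finK; exists (J `|` K); first by rewrite finite_setU.
  by rewrite /G bigcup_setU setDUr.
have [|x [Ux clx]] := cU _ PG.
  by exists set0; [exact: finite_set0|exact: subDsetl].
have [i _ yix] := Uy x Ux.
have Gi : filter_from (@finite_set I) G (G [set i]).
  by exists [set i]; [exact: finite_set1|].
have [z [[_ nz] yiz]] := clx _ _ Gi (open_nbhs_nbhs (conj (opensP (y i)) yix)).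
by apply: nz; exists i.
Qed.

(** * Points of [X] as prime elements *)

Definition closureC (x : X) : opens X :=
  Opens (closed_openC (@closed_closure X [set x])).

(** An open set that meets the closure of [x] contains [x]. *)
Lemma cle_closureC U x : cle U (closureC x) <-> ~ (U : set X) x.
Proof.
split=> [/opens_cleE UC Ux|nUx].
  by apply: (UC x Ux); exact: subset_closure.
apply/opens_cleE => y Uy /(_ U (open_nbhs_nbhs (conj (opensP U) Uy))).
by move=> [_ [-> /nUx]].
Qed.

Lemma prime_closureC x : prime_elt (closureC x).
Proof.
split=> [C1|U V].
  have /cle_closureC : cle (1 : opens X) (closureC x).
    by rewrite C1; apply/opens_cleE.
  by apply.
move=> /cle_closureC nUV; apply: contrapT => /not_orP[].
move=> /cle_closureC/contrapT Ux.
by move=> /cle_closureC/contrapT Vx; apply: nUV.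
Qed.

Lemma irreducible_prime_eltC (p : opens X) :
  prime_elt p -> irreducible (~` (p : set X)).
Proof.
move=> [p1 pM]; split.
  apply: contrapT => pT; apply: p1; apply: opens_inj; apply/seteqP.
  split=> // x _.
  by apply: contrapT => px; apply: pT; exists x.
move=> F G cF cG pFG.
have [|FCp|GCp] := pM (Opens (closed_openC cF)) (Opens (closed_openC cG)).
- apply/opens_cleE => x [nF nG]; apply: contrapT => /pFG.
  by case.
- by left; rewrite -[F]setCK; apply: subsetC; exact: (opens_cleE _ _).1 FCp.
- by right; rewrite -[G]setCK; apply: subsetC; exact: (opens_cleE _ _).1 GCp.
Qed.

(** Existence of generic points makes [closureC] onto the primes, and uniqueness makes it injective.
    The complement of [zar_V U] pulls back to [U], which gives continuity in both directions. *)
Lemma homeomorphic_zar :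
  (forall C : set X, closed C -> irreducible C ->
    exists! x, generic_point C x) ->
  homeomorphic X (zar (opens X)).
Proof.
move=> sober; pose f x := Zar (prime_closureC x).
have gen (p : zar (opens X)) : exists x, f x = p.
  have [x [xp _]] := sober _ (open_closedC (opensP (zar_val p)))
    (irreducible_prime_eltC (zarP p)).
  exists x; apply: zar_inj; apply: opens_inj => /=.
  by rewrite xp setCK.
have [g gK] := choice gen.
have fD U : f @^-1` (~` zar_V U) = U.
  apply/seteqP; split=> x /=; rewrite /zar_V /=.
    by move=> nU; apply: contrapT => /cle_closureC.
  by move=> Ux /cle_closureC.
have fK x : g (f x) = x.
  have := sober _ (@closed_closure X [set x]).
  case=> [|z [_ zuniq]].
    rewrite -[closure _]setCK.
    exact: (irreducible_prime_eltC (prime_closureC x)).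
  (* Both [x] and [g (f x)] are generic in the closure of [x]. *)
  rewrite -[RHS](zuniq x) //; apply/esym/zuniq/setC_inj.
  exact: (congr1 (fun p : zar (opens X) => zar_val p : set X) (gK (f x))).
exists f, g; split=> //; apply/continuousP => U.
  by move=> /zar_openE[V ->]; rewrite fD; exact: opensP.
move=> oU; apply/zar_openE; exists (Opens oU).
rewrite -[U]/(Opens oU : set X) -[in LHS](fD (Opens oU)).
by apply/funext => p; rewrite /preimage /= gK.
Qed.

(** * The semiring of quasi-compact opens and its prime k-ideals *)

Lemma compact_opens_closed :
  compact [set: X] ->
  (forall D : set (set X), finite_set D -> D `<=` @qc_open X ->
    qc_open (\bigcap_(U in D) U)) ->
  semiring_closed (compact_elts (opens X)).
Proof.
move=> cX capQ; split; split.
- by apply/asboolP/compact_opensE; exact: compact0.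
- move=> U V /asboolP/compact_opensE cU /asboolP/compact_opensE cV.
  by apply/asboolP/compact_opensE; exact: compactU.
- exact/asboolP/compact_opensE.
- move=> U V /asboolP/compact_opensE cU /asboolP/compact_opensE cV.
  apply/asboolP/compact_opensE.
  have [||_] := capQ [set (U : set X); (V : set X)].
  + exact: finite_set2.
  + by move=> _ [->|->]; split=> //; exact: opensP.
  + by rewrite bigcap_setU !bigcap_set1.
Qed.

Section CompactOpens.
Hypothesis basisX : basis (@qc_open X).
Variable clO : semiring_closed (compact_elts (opens X)).
Local Notation C := (subsemiring clO).
Local Notation val := (@subsemiring_val _ _ clO).

Lemma compact_opens_cleE (a b : C) : cle a b <-> cle (val a) (val b).
Proof. by split=> [/(congr1 val)|ab]; [|exact: val_inj]. Qed.

Lemma radical_compact_opens : radical_idealic_semiring C.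
Proof.
have [idem le1] := opens_idealic X.
split; first split.
- by move=> a; apply: val_inj; exact: idem.
- by move=> a; apply: val_inj; exact: le1.
- by move=> a; apply: val_inj; apply: opens_inj; exact: setIid.
Qed.

Lemma compact_opens_elt (a : C) : compact_elt (val a).
Proof. by apply/asboolP; case: a. Qed.

Lemma compact_opens_le U :
  (U : set X) = \bigcup_(a in [set a : C | cle (val a) U]) (val a : set X).
Proof.
apply/seteqP; split=> x; last by case=> a /opens_cleE; apply.
move=> Ux; have [_ /(_ x U)[]] := basisX.
  exact: open_nbhs_nbhs (conj (opensP U) Ux).
move=> V [[oV cV] Vx] VU.
have Vc : Opens oV \in compact_elts (opens X) by exact/asboolP/compact_opensE.
by exists (SubSemiring clO Vc) => //; apply/opens_cleE.
Qed.

Lemma cle_compact_opens U V :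
  (forall a : C, cle (val a) U -> cle (val a) V) -> cle U V.
Proof.
move=> UV; apply/opens_cleE; rewrite compact_opens_le => x [a /UV/opens_cleE].
by apply.
Qed.

Definition kideal_sup (I : set C) : opens X := csup (val @` I).

Definition kideal_below U : set C := [set a | cle (val a) U].

(** Compactness puts [a] below finitely many members of [I], hence below their sum [s], which is in
    [I]; then so is [a = a * s]. *)
Lemma cle_kideal_sup (I : set C) (a : C) :
  is_ideal I -> cle (val a) (kideal_sup I) <-> I a.
Proof.
move=> idI; have [I0 ID IM] := idI; split=> [aI|Ia]; last first.
  by have [ub _] := csupP (val @` I); apply: ub; exists a.
(* Indexing by the members of [I] keeps every finite subfamily inside [I]. *)
pose y (b : {b | I b}) := val (sval b).
have [|J [finJ aJ]] := compact_opens_elt (a := a) (y := y).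
  apply: cle_trans aI _; apply/opens_cleE; rewrite !opens_csupE !bigcup_image.
  by move=> x [b Ib bx]; exists (exist _ b Ib).
have [|s Is sub] := finite_ideal_ub radical_compact_opens.1.1 idI
    (finite_image sval finJ).
  by move=> _ [[b Ib] _ <-].
have ale : cle (val a) (val s).
  apply: cle_trans aJ _; have [_ lub] := csupP (y @` J).
  apply: lub => _ [b Jb <-].
  by apply/compact_opens_cleE/sub; exists b.
suff -> : a = a * s by exact: IM.
apply: val_inj; apply: opens_inj; apply/esym/setIidPl; exact/opens_cleE.
Qed.

Lemma prime_kideal_below U : prime_elt U -> prime_kideal (kideal_below U).
Proof.
move=> [U1 UM]; split.
- split; first split.
  + by apply/opens_cleE.
  + move=> a b /opens_cleE aU /opens_cleE bU.
    by apply/opens_cleE; rewrite subUset.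
  + by move=> a b; exact: cle_trans (cle_mull _ _).
  + by move=> a b _ /opens_cleE; rewrite subUset => -[_ bU]; exact/opens_cleE.
- move=> UT; apply: U1; apply: opens_inj; apply/seteqP; split=> //.
  by apply/opens_cleE; have : [set: C] 1 by []; rewrite -UT.
- move=> I J _ _ IJU; apply: contrapT => /not_orP[].
  move=> /existsNP[a /not_implyP[Ia aU]] /existsNP[b /not_implyP[Jb bU]].
  have [|//|//] := UM (val a) (val b).
  by apply: (IJU (a * b)); apply: sub_gen_smallest; exists a, b.
Qed.

(** If neither [U] nor [V] is below the join, the basis gives compact [a] below [U] and [b] below
    [V], both outside [I], although [a * b] is in [I]. *)
Lemma prime_kideal_sup I : prime_kideal I -> prime_elt (kideal_sup I).
Proof.
move=> [[idI kI] IT IM]; have [I0 ID IMl] := idI; split.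
  move=> I1; apply: IT; apply/seteqP; split=> // a _.
  apply/cle_kideal_sup => //.
  by rewrite I1; apply/opens_cleE.
move=> U V UV; apply: contrapT => /not_orP[nU nV].
have notle W : ~ cle W (kideal_sup I) -> exists2 a : C, cle (val a) W & ~ I a.
  move=> nW; apply: contrapT => na; apply: nW; apply: cle_compact_opens => a aW.
  by apply/cle_kideal_sup => //; apply: contrapT => nIa; apply: na; exists a.
have [[a aU nIa] [b bV nIb]] := (notle _ nU, notle _ nV).
have idC := radical_compact_opens.1.
have Iab : I (a * b).
  apply/cle_kideal_sup => //; apply: cle_trans UV; apply/opens_cleE.
  by apply: setISS; apply/opens_cleE.
(* For [x] below [a] and [y] below [b], the product [x * y] equals [(x * y) * (a * b)] and so lies
   in [I]. *)
have [|aI|bI] := IM _ _ (kideal_cle a idC) (kideal_cle b idC).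
- apply: smallest_sub => // _ [x [y [xa yb ->]]].
  suff -> : x * y = (x * y) * (a * b) by exact: IMl.
  apply: val_inj; apply: opens_inj; apply/esym/setIidPl; apply: setISS.
  + by apply/opens_cleE/compact_opens_cleE.
  + by apply/opens_cleE/compact_opens_cleE.
- by apply: nIa; apply: aI; exact: idC.1.
- by apply: nIb; apply: bI; exact: idC.1.
Qed.

Lemma homeomorphic_spec_k : homeomorphic (zar (opens X)) (spec_k C).
Proof.
pose f (p : zar (opens X)) := SpecK (prime_kideal_below (zarP p)).
pose g (I : spec_k C) := Zar (prime_kideal_sup (spec_kP I)).
have fK : cancel f g.
  move=> p; apply: zar_inj; apply: opens_inj => /=.
  by rewrite opens_csupE bigcup_image -compact_opens_le.
have gK : cancel g f.
  move=> I; apply: spec_k_inj; have [[idI _] _ _] := spec_kP I.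
  by apply/funext => a; apply/propext; exact: cle_kideal_sup.
exists f, g; split=> //.
  apply: continuous_spec_k => F _.
  have -> : f @^-1` spec_k_D F = \bigcup_(a in F) ~` zar_V (val a).
    apply/seteqP; split=> p /=.
      by move=> /existsNP[a /not_implyP[Fa pa]]; exists a.
    by move=> [a Fa pa] Fp; apply/pa/Fp.
  by apply: bigcup_open => a _; apply/zar_openE; exists (val a).
apply/continuousP => _ /zar_openE[U ->].
(* As [U] is the join of the compact opens below it, [U] is not below the join of [I] exactly when
   one of them is outside [I]. *)
have -> : g @^-1` (~` zar_V U) = \bigcup_(a in kideal_below U) spec_k_D [set a].
  apply/seteqP; split=> I; have [[idI _] _ _] := spec_kP I.
    move=> nU; apply: contrapT => na; apply: nU.
    apply: cle_compact_opens => a aU; apply/cle_kideal_sup => //.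
    apply: contrapT => nIa; apply: na; exists a => //.
    by move=> /(_ a erefl).
  move=> [a aU nIa] UI; apply: nIa => _ ->; apply/cle_kideal_sup => //.
  exact: cle_trans aU UI.
by apply: bigcup_open => a _; apply: spec_k_open_D; exact: finite_set1.
Qed.

End CompactOpens.
End OpenSets.

Theorem theorem3p43 (X : topologicalType) (hX : spectral_space X) :
  exists clO : semiring_closed (compact_elts (opens X)),
    radical_idealic_semiring (subsemiring clO) /\
    (homeomorphic X (zar (opens X)) /\
     homeomorphic (zar (opens X)) (spec_k (subsemiring clO))).
Proof.
have [cX _ capQ bX sober] := hX.
exists (compact_opens_closed cX capQ); split; last split.
- exact: radical_compact_opens.
- exact: homeomorphic_zar.
- exact: homeomorphic_spec_k.
Qed.
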